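(* Let $\mathcal{C}$ be a clutter with vertex set $V(\mathcal{C})=\{t_1,\ldots,t_s\}$, let $S=K[t_1,\ldots,t_s]$ be a polynomial ring over a field $K$, and let $I=I(\mathcal{C})\subset S$ be the edge ideal of $\mathcal{C}$. If $I$ is not a prime ideal, then $\mathcal{F}_\mathcal{C}\subset\mathcal{A}_\mathcal{C}$ and $$\mathrm{v}(I)=\min\{|A| \colon A\in\mathcal{A}_\mathcal{C}\}.$$
   Context: A clutter $\mathcal{C}$ is a finite vertex set $V(\mathcal{C})=\{t_1,\ldots,t_s\}$ together with a family $E(\mathcal{C})$ of nonempty subsets of $V(\mathcal{C})$, called edges, none of which is included in another. The vertices are identified with the variables of $S=K[t_1,\ldots,t_s]=\bigoplus_{d\ge 0}S_d$ (standard grading), and the edge ideal $I(\mathcal{C})$ is the ideal of $S$ generated by the monomials $t_e=\prod_{t_i\in e}t_i$ with $e\in E(\mathcal{C})$. A set $A\subset V(\mathcal{C})$ is stable if it contains no edge of $\mathcal{C}$. A set $C\subset V(\mathcal{C})$ is a vertex cover if $V(\mathcal{C})\setminus C$ is stable (equivalently, $C$ meets every edge); it is a minimal vertex cover if it is minimal with respect to inclusion among vertex covers. For a stable set $A$, the neighbor set $N_\mathcal{C}(A)$ is the set of all vertices $t_i$ such that $\{t_i\}\cup A$ contains an edge of $\mathcal{C}$. $\mathcal{F}_\mathcal{C}$ is the family of all maximal (with respect to inclusion) stable sets of $\mathcal{C}$, and $\mathcal{A}_\mathcal{C}$ is the family of all stable sets $A$ of $\mathcal{C}$ such that $N_\mathcal{C}(A)$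 is a minimal vertex cover of $\mathcal{C}$. For an ideal $I$ with $I\subsetneq\mathfrak{m}=(t_1,\ldots,t_s)$, the v-number is $\mathrm{v}(I)=\min\{d\geq 1 \mid \exists f\in S_d \text{ and } \mathfrak{p}\in\mathrm{Ass}(I)\text{ with }(I\colon f)=\mathfrak{p}\}$, where $\mathrm{Ass}(I)$ is the set of associated primes of $S/I$ and $(I\colon f)=\{g\in S \mid gf\in I\}$. *)

(* Defs.v *)
From mathcomp Require Import all_boot all_order all_algebra.
From mathcomp Require Import boolp.
From mathcomp.multinomials Require Import mpoly.

Set Implicit Arguments.
Unset Strict Implicit.
Unset Printing Implicit Defensive.

Import GRing.Theory.

Local Open Scope ring_scope.

(* A clutter whose vertices are indexed by 'I_s: the vertex t_(i+1) is the
   index i, identified with the variable 'X_i. *)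
Record clutter (s : nat) := Clutter {
  edges : {set {set 'I_s}};
  edges_nonempty : set0 \notin edges;
  edges_antichain : {in edges &, forall e1 e2 : {set 'I_s}, e1 \subset e2 -> e1 = e2}
}.

Section Combinatorics.
Variables (s : nat) (C : clutter s).
Implicit Types A U : {set 'I_s}.

Definition stable A : bool := [forall e in edges C, ~~ (e \subset A)].

Definition vertex_cover U : bool := stable (~: U).

Definition minimal_vertex_cover U : bool := minset vertex_cover U.

Definition neighbors A : {set 'I_s} :=
  [set i | [exists e in edges C, e \subset i |: A]].

Definition maximal_stable_sets : {set {set 'I_s}} :=
  [set A | maxset stable A].

Definition cover_stable_sets : {set {set 'I_s}} :=
  [set A | stable A && minimal_vertex_cover (neighbors A)].

End Combinatorics.

Section Ideals.
Variable R : comNzRingType.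
Implicit Types (I p : {pred R}) (f g : R).

Definition gen_ideal (J : finType) (P : pred J) (F : J -> R) : {pred R} :=
  [pred f | `[< exists c : J -> R, f = \sum_(j | P j) c j * F j >]].

(* idealr_closed already requires 1 \notin p. *)
Definition is_prime_ideal p : Prop := idealr_closed p /\ prime_idealr_closed p.

Definition colon I f : {pred R} := [pred g | g * f \in I].

(* colon I g is the annihilator of the class of g in R / I. *)
Definition is_associated_prime I p : Prop :=
  is_prime_ideal p /\ exists g, p =i colon I g.

End Ideals.

Definition is_min (P : nat -> Prop) (n : nat) : Prop :=
  P n /\ forall m, P m -> (n <= m)%N.

Section VNumber.
Variables (K : fieldType) (s : nat).

Definition edge_ideal (C : clutter s) : {pred {mpoly K[s]}} :=
  gen_ideal (mem (edges C)) (fun e => \prod_(i in e) 'X_i).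

(* The relation v(I) = d; it holds for no d when the set of degrees in the
   minimum is empty. *)
Definition is_v_number (I : {pred {mpoly K[s]}}) : nat -> Prop :=
  is_min (fun d => (1 <= d)%N /\
    exists (f : {mpoly K[s]}) (p : {pred {mpoly K[s]}}),
      [/\ f \is d.-homog, is_associated_prime I p & colon I f =i p]).

End VNumber.

Arguments edge_ideal K {s} C.

(* Main.v *)
(** For squarefree monomial ideals everything is detected by the substitutions
    [restr B], which set to zero the variables outside [B]: their kernels are
    the primes generated by variables, and the edge ideal is the intersection
    of the kernels of [restr B] over the stable sets [B].

    If [A] is stable and its neighbor set [N(A)] is a vertex cover, then
    [~: N(A)] is the largest stable set containing [A], so [(I : t_A)] is the
    kernel of [restr (~: N(A))], a prime; this gives [v(I) <= #|A|], and for
    [A] empty it would make [I] itself prime.  Conversely, let [(I : f) = p]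
    be prime and let [U] be the set of variables lying in [p].  Then [U] is a
    vertex cover because [I] is contained in [p], and since [I] is radical
    [f] is not in [p], so some monomial of [f] avoids [U].  Its support [A]
    has at most [deg f] elements, is stable, and satisfies [U \subset N(A)]
    because [t_i f] is in [I] for [t_i] in [U]; hence [N(A)] is a cover too. *)

Require Import Defs.
From mathcomp Require Import all_boot all_order all_algebra.
From mathcomp Require Import boolp.
From mathcomp.multinomials Require Import mpoly.

Set Implicit Arguments.
Unset Strict Implicit.
Unset Printing Implicit Defensive.

Import GRing.Theory.

(** * Stable sets, vertex covers and neighbor sets *)

Section Clutters.
Variables (s : nat) (C : clutter s).
Implicit Types (A B U V : {set 'I_s}) (i : 'I_s).

Lemma stablePn A : reflect (exists2 e, e \in edges C & e \subset A) (~~ stable C A).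
Proof.
rewrite negb_forall; apply: (iffP existsP) => [[e]|[e eC eA]]; last first.
  by exists e; rewrite eC eA.
by rewrite negb_imply negbK => /andP[]; exists e.
Qed.

Lemma stableS A B : A \subset B -> stable C B -> stable C A.
Proof.
move=> AB; apply: contraTT => /stablePn[e eC eA].
by apply/stablePn; exists e => //; apply: subset_trans AB.
Qed.

Lemma vertex_coverS U V : U \subset V -> vertex_cover C U -> vertex_cover C V.
Proof. by move=> UV; apply: stableS; rewrite setCS. Qed.

Lemma in_neighbors A i : (i \in neighbors C A) = ~~ stable C (i |: A).
Proof.
rewrite inE; apply/existsP/stablePn => [[e /andP[]]|[e eC eA]]; exists e => //.
by rewrite eC.
Qed.

Lemma stable0 : stable C set0.
Proof.
apply/negPn/stablePn => -[e eC]; rewrite subset0 => /eqP e0.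
by have := edges_nonempty C; rewrite -e0 eC.
Qed.

Lemma sub_setC_neighbors A B :
  stable C B -> A \subset B -> B \subset ~: neighbors C A.
Proof.
move=> Bst AB; apply/subsetP => i iB; rewrite inE in_neighbors negbK.
by apply: stableS Bst; rewrite subUset sub1set iB.
Qed.

(** A cover [V] inside the neighbor set misses [A], because a stable set is disjoint from its
    neighbors. If [V] also missed a neighbor [i], then [i |: A] would lie in the stable set
    [~: V]. *)
Lemma neighbors_cover_minimal A :
  stable C A -> vertex_cover C (neighbors C A) ->
  minimal_vertex_cover C (neighbors C A).
Proof.
move=> Ast NA; apply/minsetP; split=> // V Vcov VN.
apply/eqP; rewrite eqEsubset VN /=; apply/subsetP => i.
rewrite in_neighbors; apply: contraNT => iV; apply: stableS Vcov.
rewrite subUset sub1set inE iV /=.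
by apply: subset_trans (sub_setC_neighbors Ast (subxx _)) _; rewrite setCS.
Qed.

Lemma cover_stable_setsE A :
  (A \in cover_stable_sets C)
  = stable C A && vertex_cover C (neighbors C A).
Proof.
rewrite inE; case Ast: (stable C A) => //=.
by apply/idP/idP => [/minsetp|/(neighbors_cover_minimal Ast)].
Qed.

(** By maximality every vertex outside [A] is a neighbor of [A], so the complement of the neighbor
    set lies in [A] and is stable. *)
Lemma sub_maximal_cover_stable : maximal_stable_sets C \subset cover_stable_sets C.
Proof.
apply/subsetP => A; rewrite cover_stable_setsE inE => /maxsetP[Ast Amax].
rewrite Ast; apply: (stableS _ Ast); apply/subsetP => i.
rewrite inE in_neighbors negbK => iAst.
by rewrite -(Amax _ iAst) ?subsetUr ?setU11.
Qed.

Lemma cover_stable_sets_nonempty : exists A, A \in cover_stable_sets C.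
Proof.
have [A Amax _] := maxset_exists stable0.
by exists A; apply: (subsetP sub_maximal_cover_stable); rewrite inE.
Qed.

End Clutters.

(** * Generated ideals and prime ideals in commutative rings *)

Section GenIdeal.
Variables (R : comNzRingType) (J : finType) (P : pred J) (F : J -> R).
Local Open Scope ring_scope.

Lemma gen_idealP f :
  reflect (exists c : J -> R, f = \sum_(j | P j) c j * F j) (f \in gen_ideal P F).
Proof. by rewrite inE; apply: asboolP. Qed.

Lemma gen_ideal0 : 0 \in gen_ideal P F.
Proof. by apply/gen_idealP; exists (fun=> 0); rewrite big1 // => j _; rewrite mul0r. Qed.

Lemma gen_idealD f g :
  f \in gen_ideal P F -> g \in gen_ideal P F -> f + g \in gen_ideal P F.
Proof.
move=> /gen_idealP[c ->] /gen_idealP[d ->]; apply/gen_idealP.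
exists (fun j => c j + d j); rewrite -big_split /=.
by apply: eq_bigr => j _; rewrite mulrDl.
Qed.

Lemma gen_idealMl j a : P j -> a * F j \in gen_ideal P F.
Proof.
move=> Pj; apply/gen_idealP; exists (fun k => if k == j then a else 0).
rewrite (bigD1 j) //= eqxx big1 ?addr0 // => k /andP[_ /negPf ->].
by rewrite mul0r.
Qed.

End GenIdeal.

Section PrimeIdeals.
Variable R : comNzRingType.
Implicit Types p q : {pred R}.
Local Open Scope ring_scope.

Lemma eq_prime_ideal p q : p =i q -> is_prime_ideal p -> is_prime_ideal q.
Proof.
move=> pq [[p0 p1 pD] pM]; split; [split|].
- by rewrite -pq.
- by rewrite -pq.
- by move=> a u v; rewrite -!pq; apply: pD.
- by move=> u v; rewrite -!pq; apply: pM.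
Qed.

Lemma ker_prime_ideal (D : idomainType) (phi : {rmorphism R -> D}) :
  is_prime_ideal [pred x | phi x == 0].
Proof.
split; [split|].
- by rewrite inE rmorph0.
- by rewrite inE rmorph1 oner_eq0.
- by move=> a u v; rewrite !inE rmorphD rmorphM => /eqP-> /eqP->; rewrite mulr0 addr0.
- by move=> u v; rewrite !inE rmorphM mulf_eq0.
Qed.

Lemma prime_ideal_prod p (I : finType) (P : pred I) (F : I -> R) :
  is_prime_ideal p -> \prod_(i | P i) F i \in p ->
  exists2 i, P i & F i \in p.
Proof.
case=> -[_ p1 _] pM; elim/big_rec: _ => [|i x Pi IH]; first by rewrite (negPf p1).
by move/pM/orP => [?|/IH //]; exists i.
Qed.

Lemma prime_ideal_mull p a u : is_prime_ideal p -> u \in p -> a * u \in p.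
Proof. by case=> -[p0 _ pD] _ up; rewrite -[_ * _]addr0 pD. Qed.

Lemma prime_idealD p u v : is_prime_ideal p -> u \in p -> v \in p -> u + v \in p.
Proof. by case=> -[_ _ pD] _ up vp; rewrite -[u]mul1r pD. Qed.

End PrimeIdeals.

(** * Setting variables to zero *)

Section Restriction.
Variables (K : fieldType) (s : nat).
Implicit Types (A B : {set 'I_s}) (i : 'I_s) (m : 'X_{1..s}) (f g : {mpoly K[s]}).
Local Open Scope ring_scope.

Definition mnm_vars m : {set 'I_s} := [set i | m i != 0%N].

Lemma card_mnm_vars m : (#|mnm_vars m| <= mdeg m)%N.
Proof.
rewrite mdegE -sum1_card big_mkcond /=; apply: leq_sum => i _.
by rewrite inE; case: (m i).
Qed.

Definition restr B : {rmorphism {mpoly K[s]} -> {mpoly K[s]}} :=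
  comp_mpoly [tuple if i \in B then 'X_i else 0 | i < s].

Lemma restrXU B i : restr B 'X_i = if i \in B then 'X_i else 0.
Proof. by rewrite /= comp_mpolyXU -tnth_nth tnth_mktuple. Qed.

Lemma restrX B m : restr B 'X_[m] = if mnm_vars m \subset B then 'X_[m] else 0.
Proof.
rewrite [in LHS]mpolyXE_id rmorph_prod; under eq_bigr do rewrite rmorphXn restrXU.
case: ifPn => [mB|/subsetPn[i]].
  rewrite [RHS]mpolyXE_id; apply: eq_bigr => i _.
  have [//|iB] := ifPn; have [->|mi] := eqVneq (m i) 0%N; first by rewrite !expr0.
  by case/negP: iB; apply: (subsetP mB); rewrite inE.
rewrite inE => mi /negPf iB; rewrite (bigD1 i) //= iB.
by rewrite expr0n (negPf mi) mul0r.
Qed.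

Lemma restr_prod B A :
  restr B (\prod_(i in A) 'X_i) = if A \subset B then \prod_(i in A) 'X_i else 0.
Proof.
rewrite rmorph_prod; under eq_bigr do rewrite restrXU.
case: ifPn => [AB|/subsetPn[i iA /negPf iB]].
  by apply: eq_bigr => i /(subsetP AB) ->.
by rewrite (bigD1 i) //= iB mul0r.
Qed.

Lemma mcoeff_restr B f m :
  (restr B f)@_m = if mnm_vars m \subset B then f@_m else 0.
Proof.
rewrite {1}[f]mpolyE rmorph_sum /= raddf_sum /=.
under eq_bigr => k _.
  rewrite linearZ mcoeffZ; have := restrX B k; rewrite /= => ->.
  (* The test on [k] may be replaced by the test on [m], since the coefficient at [m] vanishes
     unless [k = m]; the test then no longer depends on the summation index. *)
  rewrite (_ : _ @_ m = (if mnm_vars m \subset B then (k == m)%:R else 0)); last first.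
    case: (eqVneq k m) => [->|km]; first by case: ifP; rewrite ?mcoeffX ?eqxx ?mcoeff0.
    by case: ifP => _; rewrite ?mcoeffX ?mcoeff0 ?(negPf km) ?if_same.
  over.
case: ifP => _; last by rewrite big1 // => k _; rewrite mulr0.
rewrite [in RHS](mpolyE f) raddf_sum /=; apply: eq_bigr => k _.
by rewrite mcoeffZ mcoeffX.
Qed.

(** Each monomial is either fixed or killed, so nothing cancels and the kernel is a monomial
    ideal. *)
Lemma restr_eq0P B f :
  reflect {in msupp f, forall m, ~~ (mnm_vars m \subset B)} (restr B f == 0).
Proof.
apply: (iffP eqP) => [f0 m|fB].
  rewrite mcoeff_msupp; apply: contra => mB.
  by have /mpolyP/(_ m) := f0; rewrite mcoeff_restr mB mcoeff0 => ->.
apply/mpolyP => m; rewrite mcoeff_restr mcoeff0; case: ifP => // mB.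
by apply/eqP; apply: contraLR mB; rewrite -mcoeff_msupp => /fB.
Qed.

Lemma restr_eq0S B B' f : B \subset B' -> restr B' f == 0 -> restr B f == 0.
Proof.
move=> BB' /restr_eq0P f0; apply/restr_eq0P => m /f0.
by apply: contra => /subset_trans; apply.
Qed.

Lemma dvd_prod_mnm_vars A m :
  A \subset mnm_vars m ->
  exists g, 'X_[m] = g * \prod_(i in A) 'X_i :> {mpoly K[s]}.
Proof.
move=> Am; rewrite mprodXE.
exists 'X_[m - \sum_(i in A) U_(i)]; rewrite -mpolyXD submK //.
apply/mnm_lepP => j; rewrite mnm_sumE; have [jA|jA] := boolP (j \in A).
  rewrite (bigD1 j) //= mnm1E eqxx big1 => [|k /andP[_ /negPf kj]].
    by have := subsetP Am _ jA; rewrite inE addn0 lt0n.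
  by rewrite mnm1E kj.
rewrite big1 // => k kA; rewrite mnm1E; case: eqP => // kj.
by rewrite -kj kA in jA.
Qed.

Lemma dvd_var_mnm i m :
  i \in mnm_vars m -> exists g, 'X_[m] = g * 'X_i :> {mpoly K[s]}.
Proof.
move=> im; have [|g ->] := @dvd_prod_mnm_vars [set i] m; first by rewrite sub1set.
by exists g; rewrite big_set1.
Qed.

(** * The edge ideal and its colon ideals *)

Variable C : clutter s.

(** For the converse, restricting to the support of a monomial of [f] keeps that monomial, so this
    support is not stable: it contains an edge, whose product divides the monomial. *)
Lemma edge_idealP f :
  reflect (forall B, stable C B -> restr B f == 0) (f \in edge_ideal K C).
Proof.
apply: (iffP idP) => [/gen_idealP[c ->] B Bst|fB].
  rewrite rmorph_sum big1 // => e eC; rewrite rmorphM restr_prod.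
  case: ifPn => [eB|_]; last by rewrite mulr0.
  by case/stablePn: Bst; exists e.
rewrite [f]mpolyE big_seq; elim/big_ind: _ => [|g h|m mf].
- exact: gen_ideal0.
- exact: gen_idealD.
have /stablePn[e eC em] : ~~ stable C (mnm_vars m).
  by apply/negP => /fB/restr_eq0P/(_ m mf); rewrite subxx.
have [g ->] := dvd_prod_mnm_vars em.
by rewrite scalerAl; apply: gen_idealMl.
Qed.

Lemma edge_ideal_radical f : f * f \in edge_ideal K C -> f \in edge_ideal K C.
Proof.
move=> /edge_idealP ff; apply/edge_idealP => B /ff.
by rewrite rmorphM mulf_eq0 orbb.
Qed.

Lemma colon_edge_ideal_prod A :
  A \in cover_stable_sets C ->
  colon (edge_ideal K C) (\prod_(i in A) 'X_i)
    =i [pred g | restr (~: neighbors C A) g == 0].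
Proof.
rewrite cover_stable_setsE => /andP[Ast Ncov] g; rewrite [LHS]inE [RHS]inE.
have prod0 : \prod_(i in A) 'X_i != 0 :> {mpoly K[s]}.
  by apply/prodf_neq0 => i _; rewrite -msize_poly_eq0 msizeX.
(* One stable set suffices for the test: [~: neighbors C A] contains [A], so its restriction fixes
   the product, and it contains every other stable set on which the product survives. *)
apply/edge_idealP/idP => [/(_ _ Ncov)|gN B Bst].
  rewrite rmorphM restr_prod sub_setC_neighbors // mulf_eq0.
  by rewrite (negPf prod0) orbF.
rewrite rmorphM restr_prod; have [AB|_] := ifPn; last by rewrite mulr0.
by rewrite mulf_eq0 (restr_eq0S _ gN) // sub_setC_neighbors.
Qed.

Lemma colon_edge_ideal_prod_prime A :
  A \in cover_stable_sets C ->
  is_prime_ideal (colon (edge_ideal K C) (\prod_(i in A) 'X_i)).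
Proof.
move=> AC; apply: eq_prime_ideal (ker_prime_ideal (restr (~: neighbors C A))).
by move=> g; rewrite colon_edge_ideal_prod.
Qed.

Lemma prod_var_dhomog A : \prod_(i in A) 'X_i \is [in K[s], #|A|.-homog].
Proof.
rewrite mprodXE dhomogX /= mdeg_sum -sum1_card.
by apply/eqP; apply: eq_bigr => i _; rewrite mdeg1.
Qed.

(** Supplies the bound [1 <= d] built into the v-number. *)
Lemma nonprime_cover_stable_gt0 A :
  ~ is_prime_ideal (edge_ideal K C) -> A \in cover_stable_sets C -> (0 < #|A|)%N.
Proof.
move=> Inp AC; rewrite card_gt0; apply: contra_notN Inp => /eqP A0.
apply: eq_prime_ideal (colon_edge_ideal_prod_prime AC) => g.
by rewrite inE A0 big_set0 mulr1.
Qed.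

Lemma prime_colon_cover_stable f d (p : {pred {mpoly K[s]}}) :
  f \is d.-homog -> is_prime_ideal p -> colon (edge_ideal K C) f =i p ->
  exists2 A, A \in cover_stable_sets C & (#|A| <= d)%N.
Proof.
move=> fd pp colonE; pose U := [set i | 'X_i \in p].
have sIp g : g \in edge_ideal K C -> g \in p.
  move=> gI; rewrite -colonE inE; apply/edge_idealP => B Bst.
  by rewrite rmorphM mulf_eq0; have/edge_idealP/(_ _ Bst) -> := gI.
have Ucov : vertex_cover C U.
  apply/negPn/stablePn => -[e eC eU].
  have : \prod_(i in e) 'X_i \in p.
    by apply: sIp; rewrite -[\prod_(_ in _) _]mul1r; apply: gen_idealMl.
  by case/(prime_ideal_prod pp) => i /(subsetP eU); rewrite !inE => /negPf ->.
have fI : f \notin edge_ideal K C.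
  have [[_ p1 _] _] := pp; apply: contra p1 => fI.
  by rewrite -colonE inE mul1r.
have [m mf mU] : exists2 m, m \in msupp f & mnm_vars m \subset ~: U.
  (* If every monomial of [f] involved a variable of [U], then [f] would lie in [p], the colon ideal
     of [f] itself, so [f * f] would be in the edge ideal. *)
  apply/hasP; apply: contraNT fI => /hasPn fU.
  apply: edge_ideal_radical; suff : f \in p by rewrite -colonE inE.
  rewrite [f]mpolyE big_seq; elim/big_ind: _ => [|g h|m mf].
  - by have [[]] := pp.
  - exact: prime_idealD.
  have /subsetPn[i im] := fU _ mf; rewrite inE negbK inE => ip.
  by have [g ->] := dvd_var_mnm im; rewrite scalerAl prime_ideal_mull.
exists (mnm_vars m); last by rewrite -(dhomogP _ _ _ fd m mf) card_mnm_vars.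
rewrite cover_stable_setsE (stableS _ Ucov) //=.
apply: vertex_coverS Ucov; apply/subsetP => i.
(* If [i |: mnm_vars m] were stable, restricting to it would kill ['X_i * f] but not ['X_i], hence
   kill [f], although the monomial [m] survives. *)
rewrite inE -colonE inE in_neighbors => /edge_idealP Xf; apply/negP => /[dup] st.
move/Xf; rewrite rmorphM mulf_eq0 restrXU setU11.
rewrite -msize_poly_eq0 msizeX /= => /restr_eq0P/(_ m mf).
by rewrite subsetUr.
Qed.

End Restriction.

Theorem theorem3p5 (K : fieldType) (s : nat) (C : clutter s) :
  ~ is_prime_ideal (edge_ideal K C) ->
  maximal_stable_sets C \subset cover_stable_sets C /\
  exists d : nat,
    is_v_number (edge_ideal K C) d /\
    is_min (fun n => exists2 A : {set 'I_s},
                       A \in cover_stable_sets C & n = #|A|) d.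
Proof.
move=> Inp; split; first exact: sub_maximal_cover_stable.
have [A0 A0C] := cover_stable_sets_nonempty C.
have [A AC Amin] := arg_minnP (fun A : {set 'I_s} => #|A|) A0C.
exists #|A|; split; split.
- split; first exact: nonprime_cover_stable_gt0 Inp AC.
  have pA := colon_edge_ideal_prod_prime K AC.
  (* The prime is the colon ideal itself, and the same product witnesses that it is associated. *)
  do 2 eexists; split; [exact: prod_var_dhomog | | by []].
  by split=> //; eexists.
- move=> d [_ [f [p [fd [pp _] colonE]]]].
  have [B BC] := prime_colon_cover_stable fd pp colonE.
  exact/leq_trans/Amin.
- by exists A.
- by move=> _ [B BC ->]; apply: Amin.
Qed.
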